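(* Let $\mathcal{A}$ be a unital prime $*$-algebra over a field $\mathbb{F}$, with unit $I$ and with a nontrivial symmetric idempotent $P$. Assume that the involution $*$ is of the second kind and that $\Phi:\mathcal{A}\to\mathcal{A}$ is a surjective map (not assumed additive or linear). Then $\Phi$ is strong skew commutativity preserving, that is, $\Phi(A)\Phi(B)-\Phi(B)\Phi(A)^*=AB-BA^*$ for all $A,B\in\mathcal{A}$, if and only if either $\Phi(A)=A$ for all $A\in\mathcal{A}$, or $\Phi(A)=-A$ for all $A\in\mathcal{A}$.
   Context: A $*$-algebra over $\mathbb{F}$ is an associative $\mathbb{F}$-algebra equipped with a ring involution $*$ (an additive map with $(AB)^*=B^*A^*$ and $A^{**}=A$; it is not assumed $\mathbb{F}$-linear). It is prime if for any $A,B\in\mathcal{A}$, $A\mathcal{A}B=0$ implies $A=0$ or $B=0$. Let $\mathcal{S}=\{A\in\mathcal{A}:A^*=A\}$ be the set of symmetric elements. The involution is of the first kind if $\mathbb{F}I\subseteq\mathcal{S}$ (equivalently, $*$ is $\mathbb{F}$-linear); otherwise it is of the second kind. A nontrivial symmetric idempotent is an element $P$ with $P=P^2=P^*$ and $P\neq 0$, $P\neq I$. *)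

(* Defs.v *)
From mathcomp Require Import all_boot all_algebra.

Set Implicit Arguments.
Unset Strict Implicit.
Unset Printing Implicit Defensive.

Import GRing.Theory.
Local Open Scope ring_scope.

Section StarAlgebra.
Variables (F : fieldType) (A : algType F).

(* No compatibility with the scalars is required: [star] need not be linear. *)
Definition ring_involution (star : A -> A) : Prop :=
  [/\ {morph star : x y / x + y},
      {morph star : x y / x * y >-> y * x}
    & involutive star].

Definition prime_algebra : Prop :=
  forall a b : A, (forall x : A, a * x * b = 0) -> a = 0 \/ b = 0.

Definition symmetric_elt (star : A -> A) (a : A) : Prop := star a = a.

Definition first_kind (star : A -> A) : Prop :=
  forall k : F, symmetric_elt star k%:A.

Definition second_kind (star : A -> A) : Prop := ~ first_kind star.

Definition nontrivial_symmetric_idempotent (star : A -> A) (p : A) : Prop :=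
  [/\ p = p ^+ 2, p = star p, p <> 0 & p <> 1].

Definition skew_commutator (star : A -> A) (a b : A) : A :=
  a * b - b * star a.

Definition strong_skew_commutativity_preserving
    (star : A -> A) (Phi : A -> A) : Prop :=
  forall a b : A,
    skew_commutator star (Phi a) (Phi b) = skew_commutator star a b.

End StarAlgebra.

Arguments prime_algebra {F} A.

Definition surjective (T U : Type) (f : T -> U) : Prop :=
  forall y : U, exists x : T, f x = y.

(* Main.v *)
Require Import Defs.
From mathcomp Require Import all_boot all_algebra.

Import GRing.Theory.
Local Open Scope ring_scope.

(** The skew commutator is [ [a, b] = a * b - b * star a ]. Everything rests on
    one consequence of the second kind: an element [d] with
    [y * d = d * star y] for all [y] is zero ([skew_annihilator_eq0]). Indeed,
    for a scalar [k] it says that the central element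
    [k%:A - star k%:A] kills [d]; in a prime algebra nonzero central elements
    are regular, and some [k%:A - star k%:A] is nonzero.

    Put [c = Phi 1]. Since [ [1, b] = 0 ] for all [b] and [Phi] is surjective,
    [c] is central and symmetric. For a scalar [z = k%:A],
    [ [a, z] = z * (a - star a) = z * [a, 1] ], and transporting both ends
    through [Phi] gives [ [Phi a, Phi z] = [Phi a, z * c] ]. By surjectivity the
    difference [Phi z - z * c] is annihilated as above, so [Phi z = z * c].
    Now compute [ [z, b] = (z - star z) * b ] through [Phi]: it is also
    [(z - star z) * (c * Phi b)], for every scalar [z], hence [c * Phi b = b].
    At [b = 1] this reads [c * c = 1], so [c] is [1] or [-1] by primeness, and
    [Phi b = c * b]. *)

Section PrimeAlgebra.
Variables (F : fieldType) (A : algType F).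
Hypothesis A_prime : prime_algebra A.

Definition central (a : A) : Prop := forall x, a * x = x * a.

Lemma central_scalar (k : F) : central k%:A.
Proof. by move=> x; rewrite mulr_algl mulr_algr. Qed.

Lemma centralB (a b : A) : central a -> central b -> central (a - b).
Proof. by move=> Ha Hb x; rewrite mulrBl mulrBr Ha Hb. Qed.

Lemma centralM (a b : A) : central a -> central b -> central (a * b).
Proof. by move=> Ha Hb x; rewrite -mulrA Hb mulrA Ha mulrA. Qed.

Lemma central_mul_eq0 (a b : A) : central a -> a * b = 0 -> a = 0 \/ b = 0.
Proof.
by move=> Ha ab0; apply: A_prime => x; rewrite Ha -mulrA ab0 mulr0.
Qed.

Lemma central_sqr_eq1 (c : A) : central c -> c * c = 1 -> c = 1 \/ c = -1.
Proof.
move=> cC cc1.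
have c1C : central (c - 1).
  by apply: centralB => // x; rewrite mul1r mulr1.
have /(central_mul_eq0 _ _ c1C) [] : (c - 1) * (c + 1) = 0.
- by rewrite mulrBl mul1r mulrDr mulr1 cc1 [1 + c]addrC subrr.
- by move/subr0_eq; left.
- by move/addr0_eq <-; right; rewrite opprK.
Qed.

Section Involution.
Variable star : A -> A.
Hypothesis star_inv : ring_involution star.

Lemma starD : {morph star : x y / x + y}.
Proof. by case: star_inv. Qed.

Lemma starM : {morph star : x y / x * y >-> y * x}.
Proof. by case: star_inv. Qed.

Lemma starK : involutive star.
Proof. by case: star_inv. Qed.

Lemma star1 : star 1 = 1.
Proof. by rewrite -[LHS]mulr1 -{2}[1]starK -starM mulr1 starK. Qed.

Lemma starN (a : A) : star (- a) = - star a.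
Proof.
have star0 : star 0 = 0 by apply: (addrI (star 0)); rewrite -starD !addr0.
by apply: (addrI (star a)); rewrite -starD !subrr.
Qed.

Lemma central_star (a : A) : central a -> central (star a).
Proof. by move=> Ha x; rewrite -[x]starK -!starM Ha. Qed.

Lemma skew_commutatorNN (a b : A) :
  skew_commutator star (- a) (- b) = skew_commutator star a b.
Proof. by rewrite /skew_commutator starN !mulrNN. Qed.

Lemma skew_commutatorBr (a b d : A) :
  skew_commutator star a (b - d) =
  skew_commutator star a b - skew_commutator star a d.
Proof. by rewrite /skew_commutator mulrBr mulrBl !opprD !opprK addrACA. Qed.

Lemma skew_commutator1l (b : A) : skew_commutator star 1 b = 0.
Proof. by rewrite /skew_commutator star1 mul1r mulr1 subrr. Qed.

Lemma skew_commutator_centrall (z b : A) :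
  central z -> skew_commutator star z b = (z - star z) * b.
Proof.
by move=> zC; rewrite /skew_commutator mulrBl (central_star z zC).
Qed.

Lemma skew_commutatorMr (z a b : A) :
  central z ->
  skew_commutator star a (z * b) = z * skew_commutator star a b.
Proof. by move=> zC; rewrite /skew_commutator mulrBr !mulrA (zC a). Qed.

Hypothesis star_second : second_kind star.

(** This is the only use of the second kind. Quantifying over all scalars
    instead of fixing one with [k%:A <> star k%:A] keeps the argument
    constructive. *)
Lemma scalar_skew_regular (d : A) :
  (forall k : F, (k%:A - star k%:A) * d = 0) -> d = 0.
Proof.
move=> kd0; apply/eqP/negPn/negP => d_neq0; apply: star_second => k.
have kC := central_scalar k.
case: (central_mul_eq0 _ _ (centralB _ _ kC (central_star _ kC)) (kd0 k)).
- by move/subr0_eq => /esym.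
- by move/eqP; rewrite (negPf d_neq0).
Qed.

Lemma skew_annihilator_eq0 (d : A) :
  (forall y, skew_commutator star y d = 0) -> d = 0.
Proof.
move=> yd0; apply: scalar_skew_regular => k.
by rewrite -skew_commutator_centrall //; exact: central_scalar.
Qed.

Section Preserver.
Variable Phi : A -> A.
Hypothesis Phi_surj : surjective Phi.
Hypothesis Phi_pres : strong_skew_commutativity_preserving star Phi.

Lemma Phi1_skew_commutator (y : A) : Phi 1 * y = y * star (Phi 1).
Proof.
have [b <-] := Phi_surj y; apply: subr0_eq.
by rewrite -/(skew_commutator star _ _) Phi_pres skew_commutator1l.
Qed.

Lemma star_Phi1 : star (Phi 1) = Phi 1.
Proof. by rewrite -[LHS]mul1r -Phi1_skew_commutator mulr1. Qed.

Lemma central_Phi1 : central (Phi 1).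
Proof. by move=> y; rewrite Phi1_skew_commutator star_Phi1. Qed.

(** Both sides have the same skew commutator with every [Phi a]: as [z] is
    central, it factors out of the second slot and leaves [ [a, 1] ]. *)
Lemma Phi_central (z : A) : central z -> Phi z = z * Phi 1.
Proof.
move=> zC; apply: subr0_eq; apply: skew_annihilator_eq0 => y.
have [a <-] := Phi_surj y.
rewrite skew_commutatorBr skew_commutatorMr // !Phi_pres.
by rewrite -skew_commutatorMr // mulr1 subrr.
Qed.

Lemma Phi1_mul_Phi (b : A) : Phi 1 * Phi b = b.
Proof.
apply: subr0_eq; apply: scalar_skew_regular => k.
have kC := central_scalar k.
have kcC : central (k%:A * Phi 1).
  by apply: centralM => //; exact: central_Phi1.
rewrite mulrBr -(skew_commutator_centrall _ b kC) -Phi_pres (Phi_central _ kC).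
rewrite skew_commutator_centrall // starM star_Phi1 -(central_Phi1 k%:A).
by rewrite -mulrBr [Phi 1 * (_ - _)]central_Phi1 -mulrA subrr.
Qed.

Lemma preserver_id_or_opp : (forall a, Phi a = a) \/ (forall a, Phi a = - a).
Proof.
case: (central_sqr_eq1 _ central_Phi1 (Phi1_mul_Phi 1)) => c1; [left|right] => a.
- by rewrite -[RHS]Phi1_mul_Phi c1 mul1r.
- by rewrite -[in RHS](Phi1_mul_Phi a) c1 mulN1r opprK.
Qed.

End Preserver.
End Involution.
End PrimeAlgebra.

Theorem theorem2p10 (F : fieldType) (A : algType F) (star : A -> A)
    (P : A) (Phi : A -> A)
    (star_inv : ring_involution star)
    (A_prime : prime_algebra A)
    (P_idem : nontrivial_symmetric_idempotent star P)
    (star_second : second_kind star)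
    (Phi_surj : surjective Phi) :
  strong_skew_commutativity_preserving star Phi <->
  (forall a : A, Phi a = a) \/ (forall a : A, Phi a = - a).
Proof.
split; first exact: preserver_id_or_opp.
by case=> PhiE a b; rewrite !PhiE // skew_commutatorNN.
Qed.
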